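(* Let $K$ be an algebraically closed field of characteristic different from $2$, let $n$ be an even positive integer, and let $A$ be a finite-dimensional simple $K$-algebra with involution (that is, a $*$-simple algebra) such that $A$ satisfies the identities with involution of the matrix algebra $(M_n(K),s)$ with the symplectic involution, i.e. $\mathrm{Id}(M_n(K),s)\subseteq \mathrm{Id}(A,* )$. (i) If $A$ is central (its center is $K$), then there exists an involution-preserving embedding of $A$ into $(M_n(K),s)$. (ii) If $A$ is not central, then there exists an involution-preserving embedding of $A$ into $(M_{2n}(K),s)$.
   Context: An involution on a $K$-algebra $A$ is a $K$-linear map $*\colon A\to A$ with $(ab)^*=b^*a^*$ and $(a^* )^*=a$. Put $A^+=\{a: a^*=a\}$ and $A^-=\{a: a^*=-a\}$. Let $K\langle Y,Z\rangle$ be the free associative algebra on countably many non-commuting variables $y_1,y_2,\dots$ (symmetric) and $z_1,z_2,\dots$ (skew-symmetric). A polynomial $f(y_1,\dots,y_p,z_1,\dots,z_q)\in K\langle Y,Z\rangle$ is an identity with involution ($*$-identity) of $(A,* )$ if $f(u_1,\dots,u_p,v_1,\dots,v_q)=0$ for all $u_i\in A^+$ and $v_j\in A^-$. The set of all $*$-identities of $(A,* )$ is denoted $\mathrm{Id}(A,* )$. An algebra with involution $(A,* )$ is simple as an algebra with involution ($*$-simple) if $A^2\neq 0$ and $A$ has no two-sided ideals $I$ with $I^*=I$ other than $0$ and $A$. Known classification: over algebraically closed $K$ of characteristic different from $2$, every finite-dimensional $*$-simple algebra is isomorphic, as an algebra with involution, to one of: $(M_k(K),t)$ with $t$ the transpose;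 $(M_k(K),s)$ with $k$ even and $s$ the symplectic involution; or $(M_k(K)\oplus M_k(K)^{op},ex)$, where $ex$ is the exchange involution $(a,b)\mapsto(b,a)$. The last type is exactly the non-central case. The symplectic involution on $M_{2k}(K)$ is $a^s=Ta^tT^{-1}$ with $T=\sum_{i=1}^{k}(e_{i,i+k}-e_{i+k,i})$ ($e_{ij}$ matrix units). An embedding of $K$-algebras is an injective $K$-linear multiplicative map; it is not required to send the unit to the unit. An embedding $\varphi\colon A\to B$ of algebras with involution is involution-preserving if $\varphi(a^{*})=\varphi(a)^{*}$ for all $a\in A$ (each side using the involution of the respective algebra). *)

(* Defs.v *)
From HB Require Import structures.
From mathcomp Require Import all_boot all_order all_algebra finmap.
From mathcomp.multinomials Require Import monalg.

Set Implicit Arguments.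
Unset Strict Implicit.
Unset Printing Implicit Defensive.

Import GRing.Theory.
Local Open Scope ring_scope.

(* Algebras are associative but not assumed unital, so the product is an
   explicit operation [mul] on a finite-dimensional space. *)
Definition is_algebra (K : fieldType) (A : vectType K) (mul : A -> A -> A) :=
  [/\ associative mul,
      forall a, linear (mul a)
    & forall b, linear (mul^~ b)].

Definition is_involution (K : fieldType) (A : vectType K)
    (mul : A -> A -> A) (star : A -> A) :=
  [/\ linear star,
      forall a b, star (mul a b) = mul (star b) (star a)
    & involutive star].

Definition symmetric_elt (K : fieldType) (A : vectType K) (star : A -> A)
    (a : A) := star a = a.

Definition skew_elt (K : fieldType) (A : vectType K) (star : A -> A)
    (a : A) := star a = - a.

(* [inl i] is the symmetric variable y_i, [inr j] the skew variable z_j. *)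
Notation star_var := (nat + nat)%type.

(* K<Y,Z>, the monoid algebra of the free monoid on Y and Z. *)
Notation star_poly K := {malg K[{fmonom star_var}]}.

(* The value 0 on the empty word is a dummy, see [star_identity]. *)
Definition eval_word (K : fieldType) (A : vectType K) (mul : A -> A -> A)
    (g : star_var -> A) (w : seq star_var) : A :=
  if w is x :: w' then foldl (fun a y => mul a (g y)) (g x) w' else 0.

Definition star_assign (K : fieldType) (A : vectType K) (u v : nat -> A)
    (x : star_var) : A :=
  match x with inl i => u i | inr j => v j end.

Definition star_eval (K : fieldType) (A : vectType K) (mul : A -> A -> A)
    (u v : nat -> A) (f : star_poly K) : A :=
  \sum_(w <- msupp f) f@_w *: eval_word mul (star_assign u v) w.

(* A constant term cannot be evaluated in an algebra without unit, and an
   identity of a nonzero unital algebra has none (substitute 0 for every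
   variable); hence the first condition. *)
Definition star_identity (K : fieldType) (A : vectType K)
    (mul : A -> A -> A) (star : A -> A) (f : star_poly K) : Prop :=
  f@_(mone : {fmonom star_var}) = 0 /\
  forall u v : nat -> A,
    (forall i, symmetric_elt star (u i)) -> (forall j, skew_elt star (v j)) ->
    star_eval mul u v f = 0.

Definition two_sided_ideal (K : fieldType) (A : vectType K)
    (mul : A -> A -> A) (I : {vspace A}) :=
  forall a x, x \in I -> mul a x \in I /\ mul x a \in I.

Definition star_stable (K : fieldType) (A : vectType K) (star : A -> A)
    (I : {vspace A}) :=
  forall x, (star x \in I) = (x \in I).

Definition star_simple (K : fieldType) (A : vectType K)
    (mul : A -> A -> A) (star : A -> A) :=
  (exists a b, mul a b <> 0) /\
  forall I : {vspace A}, two_sided_ideal mul I -> star_stable star I ->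
    I = 0%VS \/ I = fullv.

Definition in_center (K : fieldType) (A : vectType K) (mul : A -> A -> A)
    (z : A) := forall a, mul z a = mul a z.

(* The center is K, i.e. it consists of the scalar multiples of the unit. *)
Definition is_central (K : fieldType) (A : vectType K)
    (mul : A -> A -> A) :=
  exists e : A, [/\ left_id e mul, right_id e mul
    & forall z, in_center mul z <-> exists c : K, z = c *: e].

Definition star_embedding (K : fieldType) (A B : vectType K)
    (mulA : A -> A -> A) (starA : A -> A)
    (mulB : B -> B -> B) (starB : B -> B) (phi : {linear A -> B}) :=
  [/\ injective phi,
      forall a b, phi (mulA a b) = mulB (phi a) (phi b)
    & forall a, phi (starA a) = starB (phi a)].

(* For n = 2k this is T = \sum_(i < k) (e_(i, i+k) - e_(i+k, i)): the bound
   i < k is forced by i + k < n. It is only meaningful for even n. *)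
Definition symp_mx (K : fieldType) (n : nat) : 'M[K]_n :=
  \sum_(i < n) \sum_(j < n | j == (i + n./2)%N :> nat)
    (delta_mx i j - delta_mx j i).

Definition symp (K : fieldType) (n : nat) (a : 'M[K]_n) : 'M[K]_n :=
  symp_mx K n *m a^T *m invmx (symp_mx K n).

(* Main.v *)
(* Put m = n / 2.  A symmetric element Y of (M_n, s) has a minimal polynomial of
   degree at most m, because every Krylov space v K[Y] is isotropic for the
   underlying alternating form.  So 1, Y, ..., Y^m are linearly dependent and the
   Capelli-type polynomial
     sum_(s in S_(m+1)) sgn(s) y^(s 0 + 1) x_0 ... y^(s m + 1) x_m
   in symmetric variables is a *-identity of (M_n, s), hence of A.

   A nonzero matrix representation rho of A of least degree k is irreducible on
   rows and, by means of *, on columns, so rho is onto M_k(K) by Burnside.  If rho is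
   not injective, A = I + I^* with I = ker rho, and rho maps A^+ onto M_k(K).  If
   rho is injective, * is the adjunction of a nondegenerate bilinear form that is
   symmetric or alternating.  In an adapted basis Y diagonal with distinct
   eigenvalues and suitable X_i turn the polynomial into a Vandermonde determinant;
   so k <= m in the exchange and orthogonal cases, and k / 2 <= m in the
   symplectic case.

   Finally a |-> diag(rho a, (rho a^* )^T) is always a *-homomorphism into
   (M_(2k), s), injective by *-simplicity; in the symplectic case a Darboux basis
   makes rho itself an embedding into (M_k, s). *)

From HB Require Import structures.
Require Import Defs.
From Stdlib Require Import Classical.
From mathcomp Require Import all_boot all_order all_fingroup all_algebra finmap.
From mathcomp.multinomials Require Import monalg.

Set Implicit Arguments.
Unset Strict Implicit.
Unset Printing Implicit Defensive.

Import GRing.Theory VectorInternalTheory.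
Local Open Scope ring_scope.

(** * The Capelli-type polynomial *)

Lemma pchar2_two_neq0 (K : fieldType) : 2%N \notin [pchar K] -> 2%:R != 0 :> K.
Proof. by rewrite inE. Qed.

Lemma eq_opp_eq0 (K : fieldType) (V : lmodType K) (x : V) :
  2%:R != 0 :> K -> x = - x -> x = 0.
Proof.
move=> K2 /eqP; rewrite -addr_eq0 -mulr2n -scaler_nat scaler_eq0 (negPf K2).
by move/eqP.
Qed.

Section StarEval.
Variables (K : fieldType) (A : vectType K) (mul : A -> A -> A) (u v : nat -> A).

Lemma star_evalEw (d : {fset {fmonom star_var}}) (f : star_poly K) :
  (msupp f `<=` d)%fset ->
  star_eval mul u v f =
    \sum_(w <- d) f@_w *: eval_word mul (star_assign u v) w.
Proof.
move=> le; apply: big_fset_incl => // w _ /mcoeff_outdom ->.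
by rewrite scale0r.
Qed.

Lemma star_eval_is_linear : linear (star_eval mul u v : star_poly K -> A).
Proof.
move=> c f g; pose E := (msupp f `|` msupp g)%fset.
have lef : (msupp f `<=` E)%fset by apply: fsubsetUl.
have leg : (msupp g `<=` E)%fset by apply: fsubsetUr.
have lefg : (msupp (c *: f + g) `<=` E)%fset.
  apply: fsubset_trans (msuppD_le _ _) _.
  by apply: fsetUSS (fsubset_refl _); apply: msuppZ_le.
rewrite !(star_evalEw (d := E)) // scaler_sumr -big_split /=.
by apply: eq_bigr => w _; rewrite mcoeffD mcoeffZ scalerDl scalerA.
Qed.

HB.instance Definition _ :=
  GRing.isLinear.Build K (star_poly K) A _ (star_eval mul u v) star_eval_is_linear.

Lemma star_eval_word (w : {fmonom star_var}) :
  star_eval mul u v << w >> = eval_word mul (star_assign u v) w.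
Proof. by rewrite (star_evalEw msuppU_le) big_seq_fset1 mcoeffUU scale1r. Qed.

End StarEval.

(** Non-emptiness matters: [eval_word] sends the empty word to the dummy 0, while the empty product
    is 1. *)
Lemma eval_word_morph (K : fieldType) (A : vectType K) (mul : A -> A -> A)
    k (phi : {linear A -> 'M[K]_k.+1}) (g : star_var -> A) (w : seq star_var) :
  (forall a b, phi (mul a b) = phi a *m phi b) -> w != [::] ->
  phi (eval_word mul g w) = \prod_(x <- w) phi (g x).
Proof.
case: w => // x w phiM _ /=; rewrite big_cons.
elim/last_ind: w => [|w y IHw]; first by rewrite big_nil mulr1.
by rewrite -cats1 foldl_cat /= phiM IHw big_cat big_seq1 /= mulrA.
Qed.

(* [inl 0] is the variable y and [inl i.+1] the variable x_i. *)
Definition capelli_word m (s : 'I_m.+1 -> nat) : seq star_var :=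
  flatten [seq rcons (nseq (s i).+1 (inl 0)) (inl i.+1) | i <- index_enum 'I_m.+1].

Definition capelli_poly (K : fieldType) m : star_poly K :=
  \sum_(s : 'S_m.+1) (-1) ^+ s *:
    << (FMonom (capelli_word (fun i => s i)) : {fmonom star_var}) >>.

Lemma capelli_word_neq0 m (s : 'I_m.+1 -> nat) : capelli_word s != [::].
Proof.
rewrite /capelli_word; have := mem_index_enum (ord0 : 'I_m.+1).
by case: (index_enum _).
Qed.

Lemma capelli_const (K : fieldType) m :
  (capelli_poly K m)@_(mone : {fmonom star_var}) = 0.
Proof.
rewrite /capelli_poly raddf_sum big1 //= => s _; rewrite mcoeffZ mcoeffU1.
case: eqP => [/(congr1 (@fmonom_val _))|_]; last by rewrite mulr0.
by move=> /= E; case/negP: (capelli_word_neq0 (fun i => s i)); rewrite E fm1.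
Qed.

Lemma capelli_eval (K : fieldType) (A : vectType K) (mul : A -> A -> A)
    k (phi : {linear A -> 'M[K]_k.+1}) m (u v : nat -> A) :
  (forall a b, phi (mul a b) = phi a *m phi b) ->
  phi (star_eval mul u v (capelli_poly K m)) =
  \sum_(s : 'S_m.+1) (-1) ^+ s *:
     \prod_(i < m.+1) (phi (u 0) ^+ (s i).+1 * phi (u i.+1)).
Proof.
move=> phiM; rewrite /capelli_poly (linear_sum (star_eval mul u v)) linear_sum.
apply: eq_bigr => s _.
rewrite (linearZ_LR (star_eval mul u v)) linearZ /= star_eval_word.
rewrite (eval_word_morph _ phiM) ?capelli_word_neq0 //=.
congr (_ *: _); rewrite /capelli_word big_flatten big_map.
apply: eq_bigr => i _; rewrite -cats1 big_cat big_seq1; congr (_ * _).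
by elim: (s i).+1 => [|e IHe]; rewrite ?big_nil //= big_cons IHe exprS.
Qed.

(** Multilinearity of a product in one factor; [uniq r] ensures that [F i0] occurs only once. *)
Lemma prod_linear_at (K : fieldType) (R : algType K) (I : eqType) (r : seq I)
    (i0 : I) (F : I -> R) d (c : 'I_d -> K) (G : 'I_d -> R) :
  uniq r -> i0 \in r -> F i0 = \sum_j c j *: G j ->
  \prod_(i <- r) F i =
  \sum_j c j *: \prod_(i <- r) (if i == i0 then G j else F i).
Proof.
elim: r => //= i r IHr /andP[ir ur]; rewrite inE big_cons.
case: (eqVneq i0 i) => [-> _ ->|ni /= i0r Fi0].
  rewrite mulr_suml; apply: eq_bigr => j _; rewrite big_cons eqxx scalerAl.
  congr (_ * _); rewrite big_seq [RHS]big_seq; apply: eq_bigr => i' i'r.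
  by case: eqP => // E; rewrite -E i'r in ir.
rewrite IHr // mulr_sumr; apply: eq_bigr => j _.
by rewrite big_cons eq_sym (negPf ni) scalerAr.
Qed.

(** Composing [s] with the transposition of [a] and [b] flips its sign and leaves [r \o s]
    unchanged, so the sum is its own negative. *)
Lemma alternating_sum_eq0 (K : fieldType) (V : lmodType K) m
    (W : ('I_m.+1 -> 'I_m.+1) -> V) (r : 'I_m.+1 -> 'I_m.+1) (a b : 'I_m.+1) :
  2%:R != 0 :> K -> (forall s t, s =1 t -> W s = W t) ->
  a != b -> r a = r b ->
  \sum_(s : 'S_m.+1) (-1) ^+ s *: W (r \o s) = 0.
Proof.
move=> K2 Wext ab rab; apply: (eq_opp_eq0 K2).
rewrite {1}(reindex_inj (mulIg (tperm a b))) /= -sumrN; apply: eq_bigr => s _.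
rewrite odd_permM odd_tperm ab addbT; case: (odd_perm s);
  rewrite ?expr0 ?expr1 ?scale1r ?scaleN1r ?opprK; [|congr (- _)];
  apply: Wext => i; rewrite /= permM; case: tpermP => [->|->|] //.
Qed.

(** In the factor with [s i = d] the relation replaces [Y ^+ d] by lower powers; each resulting term
    repeats an exponent and cancels in the alternating sum. *)
Lemma capelli_eq0 (K : fieldType) k m d (Y : 'M[K]_k.+1) (X : nat -> 'M[K]_k.+1)
    (c : 'I_d -> K) :
  2%:R != 0 :> K -> (d <= m)%N -> Y ^+ d = \sum_(j < d) c j *: Y ^+ j ->
  \sum_(s : 'S_m.+1) (-1) ^+ s *:
     \prod_(i < m.+1) (Y ^+ (s i).+1 * X i.+1) = 0.
Proof.
move=> K2 dm Yd; have dm1 : (d < m.+1)%N by [].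
pose D : 'I_m.+1 := Ordinal dm1.
pose J (j : 'I_d) : 'I_m.+1 := widen_ord (ltnW dm1) j.
pose W (s : 'I_m.+1 -> 'I_m.+1) : 'M[K]_k.+1 :=
  \prod_(i < m.+1) (Y ^+ (s i).+1 * X i.+1).
(* [r j] merges the exponent [d] into the lower exponent [j]. *)
pose r j (i : 'I_m.+1) := if i == D then J j else i.
have step (s : 'S_m.+1) : W s = \sum_j c j *: W (r j \o s).
  rewrite /W (@prod_linear_at _ _ _ _ (s^-1%g D) _ d c
    (fun j => Y ^+ j.+1 * X (s^-1%g D : 'I_m.+1).+1)) ?mem_index_enum ?index_enum_uniq //.
    apply: eq_bigr => j _; congr (_ *: _); apply: eq_bigr => i _.
    rewrite /= /r; case: (eqVneq i (s^-1%g D)) => [->|ne]; first by rewrite permKV eqxx.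
    case: eqP => // E; case/eqP: ne; by rewrite -E permK.
  rewrite permKV /= exprSr Yd !mulr_suml; apply: eq_bigr => j _.
  by rewrite -!scalerAl -exprSr.
rewrite (eq_bigr (fun s : 'S_m.+1 =>
    \sum_j c j *: ((-1) ^+ s *: W (r j \o s)))); last first.
  move=> s _; rewrite -/(W s) step scaler_sumr; apply: eq_bigr => j _.
  by rewrite !scalerA mulrC.
rewrite exchange_big big1 //= => j _; rewrite -scaler_sumr.
rewrite (@alternating_sum_eq0 _ _ _ W (r j) D (J j)) ?scaler0 //.
- by move=> s t st; apply: eq_bigr => i _; rewrite st.
- by rewrite -val_eqE /= gtn_eqF.
- by rewrite /r eqxx; case: ifP.
Qed.

(** The word of [s] sends [v 0] along a chain of eigenvectors to a multiple of [v m.+1]. The signed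
    sum of the multipliers is the product of all [d i * c i] times a Vandermonde determinant. *)
Lemma capelli_neq0 (K : fieldType) k m (Y : 'M[K]_k.+1) (X : nat -> 'M[K]_k.+1)
    (v : nat -> 'rV[K]_k.+1) (d c : nat -> K) :
  (forall i, (i <= m)%N -> [/\ v i *m Y = d i *: v i, d i != 0 & c i != 0]) ->
  (forall i, (i <= m)%N -> v i *m X i.+1 = c i *: v i.+1) ->
  v m.+1 != 0 -> {in gtn m.+1 &, injective d} ->
  \sum_(s : 'S_m.+1) (-1) ^+ s *:
     \prod_(i < m.+1) (Y ^+ (s i).+1 * X i.+1) != 0.
Proof.
move=> vY vX vm d_inj.
have vYe i e : (i <= m)%N -> v i *m Y ^+ e = d i ^+ e *: v i.
  move=> /vY[vYi _ _]; elim: e => [|e IHe]; first by rewrite mulmx1 scale1r.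
  by rewrite exprS -[Y * _]/(Y *m _) mulmxA vYi -scalemxAl IHe scalerA exprS.
have vW (s : 'S_m.+1) : v 0%N *m \prod_(i < m.+1) (Y ^+ (s i).+1 * X i.+1) =
    (\prod_(i < m.+1) (d i ^+ (s i).+1 * c i)) *: v m.+1.
  (* [inord] extends the exponents to all naturals, so that induction can run over prefixes of the
     product. *)
  pose e i := (s (inord i)).+1.
  have -> : \prod_(i < m.+1) (Y ^+ (s i).+1 * X i.+1) =
            \prod_(i < m.+1) (Y ^+ (e i) * X i.+1).
    by apply: eq_bigr => i _; rewrite /e inord_val.
  have -> : \prod_(i < m.+1) (d i ^+ (s i).+1 * c i) =
            \prod_(i < m.+1) (d i ^+ (e i) * c i).
    by apply: eq_bigr => i _; rewrite /e inord_val.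
  suff H q : (q <= m.+1)%N -> v 0%N *m \prod_(i < q) (Y ^+ (e i) * X i.+1) =
      (\prod_(i < q) (d i ^+ (e i) * c i)) *: v q by exact: H.
  elim: q => [|q IHq] ltq.
    by rewrite !big_ord0 mulmx1 scale1r.
  rewrite !big_ord_recr /= -!mulmxE mulmxA IHq 1?ltnW //.
  rewrite -scalemxAl mulmxA vYe // -scalemxAl vX //.
  by rewrite !scalerA !mulrA.
apply/eqP => /(congr1 (mulmx (v 0%N))); rewrite mulmx0 mulmx_sumr => /eqP.
under eq_bigr => s _ do rewrite -scalemxAr vW scalerA.
rewrite -scaler_suml scaler_eq0 (negPf vm) orbF => /eqP E.
have: (\prod_(i < m.+1) (d i * c i)) *
   \det (Vandermonde m.+1 (\row_(i < m.+1) d i))^T = 0.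
  rewrite -{}E /determinant mulr_sumr; apply: eq_bigr => s _.
  rewrite mulrCA; congr (_ * _); rewrite -big_split /=; apply: eq_bigr => i _.
  by rewrite !mxE exprS mulrAC.
rewrite det_tr det_Vandermonde => /eqP; rewrite mulf_eq0 => /orP[] /prodf_eq0[i _].
  have [_ d0 c0] := vY i (ltn_ord i : i <= m)%N.
  by rewrite mulf_eq0 (negPf d0) (negPf c0).
case/prodf_eq0 => j ij; rewrite !mxE subr_eq0 => /eqP /d_inj.
rewrite !inE => /(_ (ltn_ord _) (ltn_ord _)) ji.
by rewrite ji ltnn in ij.
Qed.

(** * Symplectic matrices *)

Lemma symp_mxE (K : fieldType) m :
  symp_mx K (m + m) = block_mx 0 1%:M (- 1%:M) 0.
Proof.
have E (i j : 'I_(m + m)) :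
    symp_mx K (m + m) i j =
      (j == (i + m)%N :> nat)%:R - (i == (j + m)%N :> nat)%:R.
  have hm : (m + m)./2 = m by rewrite addnn doubleK.
  rewrite /symp_mx hm summxE.
  under eq_bigr => i' _ do rewrite summxE.
  under eq_bigr => i' _ do under eq_bigr => j' _ do rewrite !mxE.
  under eq_bigr => i' _ do rewrite sumrB.
  rewrite sumrB; congr (_ - _).
    rewrite (bigD1 i) //= [X in _ + X]big1 ?addr0; last first.
      by move=> i' ne; rewrite big1 // => j' _; rewrite eq_sym (negPf ne).
    case: (eqVneq (j : nat) (i + m)%N) => [ji|ne].
      rewrite (bigD1 j) /=; last exact/eqP.
      rewrite big1 ?addr0 ?eqxx // => j' /andP[_ ne].
      by rewrite eq_sym (negPf ne).
    rewrite big1 // => j' /eqP E; rewrite eqxx /=; case: eqP => // jj'.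
    by rewrite -jj' in E; rewrite E eqxx in ne.
  rewrite (bigD1 j) //= [X in _ + X]big1 ?addr0; last first.
    by move=> i' ne; rewrite big1 // => j' _; rewrite [j == _]eq_sym (negPf ne) andbF.
  case: (eqVneq (i : nat) (j + m)%N) => [ij|ne].
    rewrite (bigD1 i) /=; last exact/eqP.
    rewrite big1 ?addr0 ?eqxx // => j' /andP[_ ne].
    by rewrite [i == _]eq_sym (negPf ne).
  rewrite big1 // => j' /eqP E; rewrite eqxx andbT; case: eqP => // jj'.
  by rewrite -jj' in E; rewrite E eqxx in ne.
apply/matrixP => i j; rewrite E -[i]splitK -[j]splitK.
case: (split i) => {}i; case: (split j) => {}j /=;
  rewrite ?block_mxEul ?block_mxEur ?block_mxEdl ?block_mxEdr !mxE /=.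
- by rewrite !ltn_eqF ?subrr // ltn_addl.
- rewrite [(i + m)%N]addnC eqn_add2l [(i == _ :> nat)]ltn_eqF ?subr0.
    by rewrite eq_sym.
  by rewrite -addnA ltn_addr.
- rewrite [(j + m)%N]addnC eqn_add2l [(j == _ :> nat)]ltn_eqF ?sub0r //.
  by rewrite -addnA ltn_addr.
- by rewrite -!addnA !eqn_add2l !ltn_eqF ?subrr // ltn_addl.
Qed.

Lemma symp_mx_sqr (K : fieldType) n :
  ~~ odd n -> symp_mx K n *m symp_mx K n = - 1%:M.
Proof.
move=> en; rewrite -(even_halfK en) -addnn symp_mxE mulmx_block.
rewrite !mul0mx !mulmx0 !mulmx1 !mulmxN !mulmx1 !addr0 !add0r.
by rewrite scalar_mx_block opp_block_mx !oppr0.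
Qed.

Lemma symp_mx_tr (K : fieldType) n : ~~ odd n -> (symp_mx K n)^T = - symp_mx K n.
Proof.
move=> en; rewrite -(even_halfK en) -addnn symp_mxE tr_block_mx opp_block_mx.
by rewrite !trmx0 !oppr0 opprK linearN /= trmx1.
Qed.

Lemma symp_mx_unit (K : fieldType) n : ~~ odd n -> symp_mx K n \in unitmx.
Proof.
move=> en; have /mulmx1_unit[] // : symp_mx K n *m - symp_mx K n = 1%:M.
by rewrite mulmxN symp_mx_sqr // opprK.
Qed.

Lemma symp_mx_inv (K : fieldType) n :
  ~~ odd n -> invmx (symp_mx K n) = - symp_mx K n.
Proof.
move=> en; apply: (can_inj (mulKmx (symp_mx_unit K en))).
by rewrite mulmxV ?symp_mx_unit // mulmxN symp_mx_sqr // opprK.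
Qed.

(* The witness is a point (1, c, c^2, ...) of the moment curve. *)
Lemma generic_row (K : closedFieldType) n p (Ms : seq 'M[K]_(n, p)) :
  all (predC1 0) Ms -> exists v : 'rV[K]_n, all (fun M => v *m M != 0) Ms.
Proof.
move=> Ms0.
pose q (M : 'M[K]_(n, p)) : {poly K} :=
  if [pick j | col j M != 0] is Some j then rVpoly (col j M)^T else 0.
have q0 (M : 'M[K]_(n, p)) : M != 0 -> q M != 0.
  rewrite /q; case: pickP => [j cj _|all0].
    apply: contra cj => /eqP/(congr1 (@poly_rV K n)).
    by rewrite rVpolyK linear0 => /(congr1 trmx); rewrite trmxK trmx0 => ->.
  case/eqP; apply/matrixP => i j; move/negbFE/eqP/colP/(_ i): (all0 j).
  by rewrite !mxE.
have /closed_nonrootP[c nr] : \prod_(M <- Ms) q M != 0.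
  by rewrite prodf_seq_neq0; apply: sub_all Ms0 => M; apply: q0.
exists (\row_i c ^+ i); apply/allP => M MMs.
have: ~~ root (q M) c.
  apply: contra nr => rM; rewrite (big_rem M) //= rootM rM //.
apply: contra => /eqP vM0; rewrite /q; case: pickP => [j _|_]; last exact: root0.
rewrite /root (@horner_coef_wide _ n) ?size_poly //; apply/eqP.
have := congr1 (fun N : 'rV__ => N 0 j) vM0; rewrite !mxE => E; rewrite -[RHS]E.
apply: eq_bigr => i _; rewrite !mxE coef_rVpoly_ord !mxE mulrC //.
Qed.

(** Take [v] not killed by [mu %/ ('X - r%:P)] at [Y], for any root [r] of the minimal polynomial
    [mu]. A proper divisor of [mu] divides one of these cofactors, so it cannot annihilate [v]. *)
Lemma mxminpoly_cyclic (K : closedFieldType) n (Y : 'M[K]_n.+1) :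
  exists v : 'rV[K]_n.+1,
    forall p, v *m horner_mx Y p = 0 -> mxminpoly Y %| p.
Proof.
set mu := mxminpoly Y; have mu0 : mu != 0 by rewrite monic_neq0 ?mxminpoly_monic.
have [rs mu_rs] := closed_field_poly_normal mu.
have rsP r : root mu r -> r \in rs.
  by rewrite mu_rs rootZ ?lead_coef_eq0 // root_prod_XsubC.
have divK r : root mu r -> mu %/ ('X - r%:P) * ('X - r%:P) = mu.
  by move=> rmu; rewrite divpK // dvdp_XsubCl.
have [|v] := @generic_row K _ _
    [seq horner_mx Y (mu %/ ('X - r%:P)) | r <- rs & root mu r].
  apply/allP => M /mapP[r]; rewrite mem_filter => /andP[/divK rmu _] ->.
  have q0 : mu %/ ('X - r%:P) != 0.
    by apply: contra mu0 => /eqP E; rewrite -rmu E mul0r.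
  apply/eqP => /mxminpoly_min/dvdp_leq => /(_ q0).
  by rewrite -/mu -{1}rmu size_Mmonic ?monicXsubC // size_XsubC addn2 ltnn.
(* By Bezout [g] annihilates [v] too; it remains to show that [g] is associate to [mu]. *)
move=> /allP vP; exists v => p vp0; pose g := gcdp p mu.
have vg0 : v *m horner_mx Y g = 0.
  have [[a b] /= ab] := Bezoutp p mu.
  have /eqpP[[c1 c2] /= /andP[c1n c2n] E] := ab.
  apply: (scalerI c2n); rewrite scaler0 scalemxAr -linearZ /= -E.
  rewrite linearZ /= [a * p]mulrC rmorphD !rmorphM /= mx_root_minpoly mulr0 addr0.
  by rewrite -scalemxAr -mulmxE mulmxA vp0 mul0mx scaler0.
have g_mu : g %| mu by apply: dvdp_gcdr.
have muE : mu %/ g * g = mu by rewrite divpK.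
have [s1|/closed_rootP[r rr]] := eqVneq (size (mu %/ g)) 1%N.
  apply: dvdp_trans (dvdp_gcdl p mu); rewrite -/g.
  have /size_poly1P[c c0 Ec] := introT eqP s1.
  by rewrite -muE Ec mul_polyC dvdpZl.
have rmu : root mu r by rewrite -muE rootM rr.
have /vP/negP[] : horner_mx Y (mu %/ ('X - r%:P)) \in
    [seq horner_mx Y (mu %/ ('X - r%:P)) | r <- rs & root mu r].
  by apply/mapP; exists r; rewrite // mem_filter rmu rsP.
have -> : mu %/ ('X - r%:P) = g * (mu %/ g %/ ('X - r%:P)).
  apply: (@mulIf _ ('X - r%:P)); rewrite ?polyXsubC_eq0 // divK //.
  by rewrite -mulrA divpK ?dvdp_XsubCl // mulrC.
by rewrite rmorphM /= -mulmxE mulmxA vg0 mul0mx.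
Qed.

Lemma skew_quadratic_eq0 (K : fieldType) n (S : 'M[K]_n) (v : 'rV[K]_n) :
  2%:R != 0 :> K -> S^T = - S -> v *m S *m v^T = 0.
Proof.
move=> K2 ST; apply: (eq_opp_eq0 K2).
have <- : (v *m S *m v^T)^T = - (v *m S *m v^T).
  by rewrite !trmx_mul trmxK ST mulNmx mulmxN mulmxA.
by apply/matrixP => i j; rewrite !ord1 [RHS]mxE.
Qed.

(* The Krylov space of a vector is isotropic for the alternating form, and some
   Krylov space has the dimension of the algebra generated by [Y]. *)
Lemma degree_mxminpoly_symplectic (K : closedFieldType) n (J Y : 'M[K]_n.+1) :
  2%:R != 0 :> K -> J \in unitmx -> J^T = - J -> Y *m J = J *m Y^T ->
  ((degree_mxminpoly Y).*2 <= n.+1)%N.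
Proof.
move=> K2 Ju JT YJ; have [v vP] := mxminpoly_cyclic Y.
set d := degree_mxminpoly Y.
pose Kr : 'M[K]_(d, n.+1) := \matrix_(i < d) (v *m Y ^+ i).
have Kfree : row_free Kr.
  apply: inj_row_free => u uKr.
  have /vP : v *m horner_mx Y (rVpoly u) = 0.
    rewrite -[RHS]uKr [RHS]mulmx_sum_row [rVpoly u]poly_def.
    rewrite (linear_sum (horner_mx Y)) mulmx_sumr.
    apply: eq_bigr => i _.
    by rewrite valK linearZ rmorphXn /= horner_mx_X rowK scalemxAr.
  move=> mu_u; rewrite -[u]rVpolyK; suff -> : rVpoly u = 0 by rewrite linear0.
  apply/eqP; apply: contraT => /dvdp_leq/(_ mu_u).
  by rewrite size_mxminpoly leqNgt ltnS size_poly.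
have YJe e : Y ^+ e *m J = J *m (Y ^+ e)^T.
  elim: e => [|e IHe]; first by rewrite trmx1 mulmx1 mul1mx.
  by rewrite {1}exprSr -mulmxE -mulmxA YJ mulmxA IHe -mulmxA -trmx_mul mulmxE exprS.
have iso : Kr *m J *m Kr^T = 0.
  apply/matrixP => i j.
  (* Moving the power of [Y] across [J] turns the entry into a value of the quadratic form of
     [Y ^+ (i + j) *m J], which is skew. *)
  have -> : (Kr *m J *m Kr^T) i j = (v *m (Y ^+ (i + j) *m J) *m v^T) 0 0.
    transitivity ((row i Kr *m J *m (row j Kr)^T) 0 0).
      by rewrite -!row_mul tr_row !mxE; apply: eq_bigr => l _; rewrite !mxE.
    rewrite !rowK trmx_mul !mulmxA -[_ *m J *m _]mulmxA -YJe.
    by rewrite exprD -mulmxE !mulmxA.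
  rewrite skew_quadratic_eq0 ?mxE // trmx_mul JT mulNmx YJe //.
have := mulmx0_rank_max iso; rewrite mxrankMfree ?row_free_unit // mxrank_tr.
by rewrite (eqP Kfree) addnn.
Qed.

Lemma capelli_symp_identity (K : closedFieldType) n :
  2%:R != 0 :> K -> (0 < n)%N -> ~~ odd n ->
  star_identity (@mulmx K n n n) (@symp K n) (capelli_poly K n./2).
Proof.
case: n => // n K2 _ en; split; first exact: capelli_const.
move=> u v usym _; set Y := u 0%N.
have YJ : Y *m symp_mx K n.+1 = symp_mx K n.+1 *m Y^T.
  by rewrite -{1}[Y](usym 0%N) /symp mulmxKV // symp_mx_unit.
have := degree_mxminpoly_symplectic K2 (symp_mx_unit K en) (symp_mx_tr K en) YJ.
set d := degree_mxminpoly Y => led.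
have {}led : (d <= n.+1./2)%N by rewrite -leq_double even_halfK.
have ev := @capelli_eval K _ (@mulmx K n.+1 n.+1 n.+1) n idfun n.+1./2 u v.
rewrite /= in ev; rewrite ev //.
(* The relation is the monic minimal polynomial of [Y] solved for [Y ^+ d]. *)
apply: (@capelli_eq0 _ _ _ d _ u (fun j => - (mxminpoly Y)`_j)) => //.
have := mx_root_minpoly Y; rewrite -{1}[mxminpoly Y]coefK.
rewrite poly_def size_mxminpoly big_ord_recr /= linearD /=.
rewrite (linear_sum (horner_mx Y)) /=.
have := mxminpoly_monic Y; rewrite monicE lead_coefE size_mxminpoly => /eqP -> /=.
rewrite scale1r rmorphXn /= horner_mx_X => /eqP; rewrite addrC addr_eq0 => /eqP ->.
rewrite -sumrN; apply: eq_bigr => j _.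
by rewrite linearZ rmorphXn /= horner_mx_X scaleNr.
Qed.

(** An algebraically closed field is infinite: a non-root of the product of ['X - y%:P] over 0 and
    the elements already chosen is a new element. *)
Lemma distinct_nonzero (K : closedFieldType) m :
  exists d : nat -> K, (forall i, (i < m)%N -> d i != 0) /\
    {in gtn m &, injective d}.
Proof.
suff [s [szs us s0]] : exists s : seq K, [/\ size s = m, uniq s & 0 \notin s].
  exists (nth 0 s); split=> [i im|i j].
    by apply: contra s0 => /eqP <-; rewrite mem_nth ?szs.
  by rewrite !inE => im jm /eqP; rewrite nth_uniq ?szs // => /eqP.
elim: m => [|m [s [szs us s0]]]; first by exists [::].
have /closed_nonrootP[x] : \prod_(y <- 0 :: s) ('X - y%:P) != 0 :> {poly K}.
  by rewrite monic_neq0 // monic_prod_XsubC.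
rewrite root_prod_XsubC inE negb_or => /andP[x0 xs].
by exists (x :: s); rewrite /= szs xs us inE negb_or eq_sym x0.
Qed.

(** If [m < l], a symmetric element with distinct nonzero eigenvalues on the [v i], together with
    symmetric elements moving each [v j] to [v j.+1], gives the polynomial a nonzero value. *)
Lemma capelli_bound (K : closedFieldType) (A : vectType K) (mul : A -> A -> A)
    (star : A -> A) k (phi : {linear A -> 'M[K]_k}) m l (v : nat -> 'rV[K]_k)
    (c : nat -> K) :
  star 0 = 0 -> star_identity mul star (capelli_poly K m) ->
  (forall a b, phi (mul a b) = phi a *m phi b) ->
  (forall i, (i < l)%N -> v i != 0 /\ c i != 0) ->
  (forall d : nat -> K, exists a, symmetric_elt star a /\
     forall i, (i < l)%N -> v i *m phi a = d i *: v i) ->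
  (forall j, (j.+1 < l)%N -> exists a, symmetric_elt star a /\
     v j *m phi a = c j *: v j.+1) ->
  (l <= m)%N.
Proof.
case: k phi v => [|k] phi v star0 [_ fA] phiM vc symY symX.
  by case: l vc {symY symX} => // l /(_ 0%N isT)[]; rewrite [v _]thinmx0 eqxx.
rewrite leqNgt; apply/negP => ml.
have [d [d0 dinj]] := distinct_nonzero K m.+1.
have [y [ysym yP]] := symY d; have [e [esym eP]] := symY (fun=> 1).
(* The chain has one vector more than [m < l] provides; its last step repeats [v m], where [e] acts
   as the identity. *)
pose v' i := if (i <= m)%N then v i else v m.
pose c' i := if (i < m)%N then c i else 1.
have xP (i : 'I_m.+1) : exists a, symmetric_elt star a /\
    v' i *m phi a = c' i *: v' i.+1.
  have im := ltn_ord i; rewrite /v' /c' -ltnS im.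
  have [i_m|] := ltnP i m; first by apply: symX; apply: leq_trans ml.
  move=> mi; exists e; split=> //; rewrite eP ?(leq_trans im) //.
  by congr (_ *: v _); apply/eqP; rewrite eqn_leq mi -ltnS im.
have [f fP] := fin_all_exists xP.
pose u i := if i is j.+1 then f (inord j) else y.
have usym i : symmetric_elt star (u i) by case: i => [|i] //=; case: (fP (inord i)).
have := capelli_eval m u (fun=> 0) phiM.
rewrite fA ?linear0 //; last by move=> j; rewrite /skew_elt oppr0.
apply/eqP; rewrite eq_sym.
apply: (@capelli_neq0 _ _ _ _ (fun i => phi (u i)) v' d c') => //.
- move=> i im; split; last 2 first.
  + exact: d0.
  + rewrite /c'; case: ifP => [i_m|_]; last exact: oner_neq0.
    by have [] := vc i (leq_ltn_trans im ml).
  + by rewrite /v' im; apply: yP; apply: leq_ltn_trans ml.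
- move=> i im; have := (fP (inord i)).2; rewrite inordK //.
- by rewrite /v' ltnn; case: (vc m ml).
Qed.

(** * Bilinear forms and Burnside's theorem *)

Lemma classical_min (P : nat -> Prop) :
  (exists n, P n) -> exists n, P n /\ forall i, (i < n)%N -> ~ P i.
Proof.
case=> n; elim/ltn_ind: n => n IHn Pn.
have [[i [i_n Pi]]|no] := classic (exists i, (i < n)%N /\ P i).
  exact: IHn Pi.
by exists n; split=> // i i_n Pi; apply: no; exists i.
Qed.

Lemma classical_max (P : nat -> Prop) k :
  P 0%N -> (forall n, P n -> (n <= k)%N) -> exists n, P n /\ ~ P n.+1.
Proof.
move=> P0 Pk; apply: NNPP => no.
have all n : P n.
  by elim: n => // n Pn; apply: NNPP => nP; apply: no; exists n.
by have := Pk _ (all k.+1); rewrite ltnn.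
Qed.

(** By polarization a nonzero symmetric form takes a nonzero value at some [(v, v)]. Complete [v] to
    a basis, split off its line and recurse on the Schur complement. *)
Lemma symmetric_diagonalize (K : fieldType) k (T : 'M[K]_k) :
  2%:R != 0 :> K -> T^T = T ->
  exists2 P, P \in unitmx & exists d : 'rV[K]_k, P *m T *m P^T = diag_mx d.
Proof.
move=> K2; elim: k T => [|k IHk] T TT.
  by exists 1%:M; [apply: unitmx1 | exists 0; apply/matrixP => -[]].
have [->|T0] := eqVneq T 0.
  exists 1%:M; first exact: unitmx1.
  by exists 0; rewrite mulmx0 mul0mx linear0.
have [v vT] : exists v : 'rV_k.+1, v *m T *m v^T != 0.
  apply: NNPP => no; case/negP: T0; apply/eqP.
  have q0 (v : 'rV_k.+1) : v *m T *m v^T = 0.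
    by apply: NNPP => ne; apply: no; exists v; apply/eqP.
  have b0 (v w : 'rV_k.+1) : v *m T *m w^T = 0.
    apply: (eq_opp_eq0 K2); apply/eqP; rewrite -addr_eq0.
    have E : w *m T *m v^T = v *m T *m w^T.
      have <- : (v *m T *m w^T)^T = w *m T *m v^T.
        by rewrite !trmx_mul TT trmxK mulmxA.
      by apply/matrixP => i j; rewrite !ord1 mxE.
    have := q0 (v + w); rewrite linearD /= !mulmxDl !mulmxDr !q0 add0r addr0 E.
    by move/eqP.
  apply/matrixP => i j; have := b0 (delta_mx 0 i) (delta_mx 0 j).
  rewrite -rowE trmx_delta -colE => /matrixP/(_ 0 0); by rewrite !mxE.
(* An invertible matrix whose first row is proportional to [v]. *)
pose Q := row_ebase v.
have [c vQ] : exists c, v = c *: row 0 Q.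
  exists (col_ebase v 0 0); rewrite -{1}[v]mulmx_ebase rowE -/Q.
  have v0 : v != 0 by apply: contra vT => /eqP ->; rewrite !mul0mx.
  rewrite rank_rV v0 scalemxAl; congr (_ *m _).
  apply/matrixP => i j; rewrite !ord1 !mxE big_ord1 !mxE.
  by case: j => [[|j] lj] /=; rewrite ?andbT ?andbF.
have [S defS] : {S : 'M_(1 + k) | S = Q *m T *m Q^T} by exists (Q *m T *m Q^T).
have ST : S^T = S by rewrite defS !trmx_mul trmxK TT mulmxA.
have a0 : S 0 0 != 0.
  apply: contra vT => /eqP S0; rewrite vQ linearZ /= -!scalemxAl -scalemxAr.
  rewrite (_ : row 0 Q *m T *m (row 0 Q)^T = 0) ?scaler0 //.
  apply/matrixP => i j; rewrite !ord1 [RHS]mxE -S0 defS -!row_mul tr_row !mxE.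
  by apply: eq_bigr => l _; rewrite !mxE.
pose a := ulsubmx S; pose b := dlsubmx S; pose D := drsubmx S.
have bT : ursubmx S = b^T by rewrite /b trmx_dlsub ST.
have SE : S = block_mx a b^T b D by rewrite -bT submxK.
have aE : a = (S 0 0)%:M.
  apply/matrixP => i j; rewrite !ord1 !mxE eqxx mulr1n; congr (S _ _); exact: val_inj.
pose L : 'M_(1 + k) := block_mx 1%:M 0 (- (S 0 0)^-1 *: b) 1%:M.
have DT : D^T = D by rewrite /D trmx_drsub ST.
pose D' := D - (S 0 0)^-1 *: (b *m b^T).
have [|P' P'u [d' d'P]] := IHk D'.
  by rewrite /D' linearB linearZ /= trmx_mul trmxK DT.
have LSL : L *m S *m L^T = block_mx (S 0 0)%:M 0 0 D'.
  rewrite {1}SE aE /L tr_block_mx !mulmx_block !trmx1 !trmx0 !mul1mx !mul0mx !mulmx0.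
  rewrite !mulmx1 !addr0 !linearZ /= !mul_scalar_mx -!scalemxAl !mul_mx_scalar.
  rewrite !scalerA mulNr mulVf // !scaleN1r !addNr mul0mx scaler0 add0r.
  by rewrite scaleNr addrC.
pose B : 'M_(1 + k) := block_mx 1%:M 0 0 P'.
exists (B *m L *m Q).
  rewrite !unitmx_mul row_ebase_unit andbT; apply/andP; split.
    by rewrite unitmxE (@det_ublock _ 1 k) det1 mul1r -unitmxE.
  by rewrite unitmxE (@det_lblock _ 1 k) !det1 mul1r unitr1.
exists (row_mx (S 0 0)%:M d').
have -> : B *m L *m Q *m T *m (B *m L *m Q)^T = B *m (L *m S *m L^T) *m B^T.
  by rewrite defS !trmx_mul !mulmxA.
rewrite LSL /B (@tr_block_mx _ 1 k 1 k) !trmx0 trmx1.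
rewrite !(@mulmx_block _ 1 k 1 k 1 k) !mul1mx !mul0mx !mulmx0 !mulmx1.
rewrite !addr0 !add0r mul0mx d'P (@diag_mx_row _ k 1).
have -> // : diag_mx (S 0 0)%:M = (S 0 0)%:M :> 'M_1.
by apply/matrixP => i j; rewrite !ord1 !mxE.
Qed.

(* A maximal isotropic space is its own orthogonal, hence of dimension k / 2; a
   dual complement is then made isotropic by subtracting half its Gram matrix. *)
Lemma skew_darboux (K : fieldType) k (T : 'M[K]_k) :
  2%:R != 0 :> K -> T^T = - T -> T \in unitmx ->
  exists l (P : 'M[K]_(l + l, k)),
    k = (l + l)%N /\ P *m T *m P^T = symp_mx K (l + l).
Proof.
move=> K2 TT Tu.
have [|l' [U Uf]|l [[U Uf UTU] maxl]] := @classical_max (fun l =>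
    exists2 U : 'M[K]_(l, k), row_free U & U *m T *m U^T = 0) k.
- by exists 0; rewrite ?mul0mx // /row_free mxrank0.
- by move=> _; rewrite -(eqP Uf) rank_leq_col.
have sUW : (U <= kermx (T *m U^T))%MS by apply/sub_kermxP; rewrite mulmxA.
have sWU : (kermx (T *m U^T) <= U)%MS.
  apply/rV_subP => v /sub_kermxP vTU; apply: NNPP => /negP nvU; apply: maxl.
  rewrite mulmxA in vTU; have UTv : U *m T *m v^T = 0.
    apply: trmx_inj; rewrite !trmx_mul trmxK TT mulNmx mulmxN mulmxA vTU.
    by rewrite oppr0 trmx0.
  rewrite -addn1; exists (col_mx U v); last first.
    rewrite tr_col_mx mul_col_mx mul_col_row UTU vTU UTv skew_quadratic_eq0 //.
    by rewrite -block_mx0.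
  apply: inj_row_free => w; rewrite -[w]hsubmxK mul_row_col.
  set w1 := lsubmx w; set w2 := rsubmx w; rewrite [w2]mx11_scalar mul_scalar_mx.
  have [->|c0] := eqVneq (w2 0 0) 0.
    rewrite scale0r addr0 => /eqP; rewrite mulmx_free_eq0 // => /eqP ->.
    by rewrite raddf0 row_mx0.
  move=> /eqP; rewrite addrC addr_eq0 => /eqP E; case/negP: nvU.
  by rewrite -[v](scalerK c0) E scalemx_sub // eqmx_opp submxMl.
have rTU : \rank (T *m U^T) = l.
  by rewrite -mxrank_tr trmx_mul trmxK mxrankMfree ?row_free_unit ?unitmx_tr // (eqP Uf).
have kl : k = (l + l)%N.
  apply/eqP.
  have := mxrankS sUW; have := mxrankS sWU; rewrite mxrank_ker rTU (eqP Uf).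
  have lk : (l <= k)%N by rewrite -(eqP Uf) rank_leq_col.
  by rewrite leq_subLR => le1; rewrite leq_subRL // eqn_leq le1.
exists l.
have UTf : row_free (U *m T) by rewrite /row_free mxrankMfree // row_free_unit.
pose U' := (pinvmx (U *m T))^T.
have UTU' : U *m T *m U'^T = 1%:M by rewrite trmxK mulmxVp.
have U'TU : U' *m T *m U^T = - 1%:M.
  apply: trmx_inj; rewrite !trmx_mul trmxK TT mulNmx mulmxN mulmxA UTU'.
  by rewrite linearN /= trmx1.
pose S := U' *m T *m U'^T.
have ST : S^T = - S by rewrite /S !trmx_mul trmxK TT mulNmx mulmxN mulmxA.
pose V := U' - 2%:R^-1 *: (S *m U).
exists (col_mx U V); split=> //.
rewrite tr_col_mx mul_col_mx mul_col_row UTU symp_mxE.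
have VT : V^T = U'^T + 2%:R^-1 *: (U^T *m S).
  by rewrite linearB linearZ /= trmx_mul ST mulmxN scalerN opprK.
have UTV : U *m T *m V^T = 1%:M.
  by rewrite VT mulmxDr -scalemxAr mulmxA UTU mul0mx scaler0 addr0.
have VTX (X : 'M_(k, l)) :
    V *m T *m X = U' *m T *m X - 2%:R^-1 *: (S *m (U *m T *m X)).
  by rewrite /V !mulmxBl -!scalemxAl !mulmxA.
rewrite !VTX UTV UTU mulmx0 scaler0 subr0 U'TU mulmx1 VT mulmxDr -/S -scalemxAr.
rewrite [U' *m T *m _]mulmxA U'TU mulNmx mul1mx scalerN; congr block_mx.
rewrite -{1}[S]scale1r -!scalerBl -addrA -opprD -mulr2n.
by rewrite -[_^-1 *+ 2]mulr_natr mulVf // subrr scale0r.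
Qed.

(** * Burnside's theorem for an action irreducible on rows and on columns *)

Section Burnside.
Variables (K : closedFieldType) (A : vectType K) (mul : A -> A -> A).
Variables (k : nat) (rho : {linear A -> 'M[K]_k}).
Hypothesis rhoM : forall a b, rho (mul a b) = rho a *m rho b.
Hypothesis rho_neq0 : exists a, rho a != 0.
Hypothesis row_irr : forall v u : 'rV[K]_k, v != 0 -> exists a, v *m rho a = u.
Hypothesis col_irr : forall v u : 'cV[K]_k, v != 0 -> exists a, rho a *m v = u.

(* If rho a has minimal rank, then rho a rho b rho a - c rho a drops rank for an
   eigenvalue c, so it vanishes. *)
Lemma burnside_rank1 :
  exists a, exists w : 'cV[K]_k, exists v : 'rV[K]_k,
    [/\ rho a = w *m v, w != 0 & v != 0].
Proof.
have [|r [[a [a0 ra]] minr]] := @classical_min (fun r =>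
    exists a, rho a != 0 /\ \rank (rho a) = r).
  by have [a a0] := rho_neq0; exists (\rank (rho a)), a.
have scal b : exists c, rho a *m rho b *m rho a = c *: rho a.
  pose B := row_base (rho a); pose C := col_base (rho a).
  have CB : C *m B = rho a by apply: mulmx_base.
  clearbody B C.
  (* [Z] is square of size the minimal rank [r], and an eigenvalue [c] makes [C *m (Z - c%:M) *m B]
     drop below rank [r]. *)
  pose Z := B *m rho b *m C.
  have [c cP] : exists c, eigenvalue Z c.
    have /closed_rootP[c] : size (char_poly Z) != 1%N.
      by rewrite size_char_poly eqSS mxrank_eq0.
    by exists c; rewrite eigenvalue_root_char.
  exists c; apply: NNPP => ne.
  have aba : rho (mul (mul a b) a - c *: a) = C *m (Z - c%:M) *m B.
    rewrite linearB linearZ /= !rhoM mulmxBr mulmxBl mul_mx_scalar -scalemxAl.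
    by rewrite CB /Z !mulmxA CB -[_ *m C *m B]mulmxA CB.
  apply: (minr (\rank (rho (mul (mul a b) a - c *: a)))).
    rewrite aba (leq_ltn_trans (mxrankM_maxl _ _)) //.
    rewrite (leq_ltn_trans (mxrankM_maxr _ _)) // -ra ltn_neqAle rank_leq_col andbT.
    by move: cP; rewrite /eigenvalue /eigenspace kermx_eq0.
  exists (mul (mul a b) a - c *: a); split=> //.
  rewrite linearB linearZ /= !rhoM subr_eq0; exact/eqP.
have [i ai] : exists i, row i (rho a) != 0.
  by apply/existsP; apply: contraNT a0 => /existsPn no; apply/eqP/row_matrixP => i;
     rewrite row0; apply/eqP; rewrite -[_ == _]negbK no.
(* By irreducibility [u] is [row i (rho a) *m rho b] for some [b], so [scal] applies to row [i].
   Hence all rows of [rho a] are proportional. *)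
have uE (u : 'rV[K]_k) : exists c, u *m rho a = c *: row i (rho a).
  have [b bP] := row_irr u ai; have [c cP] := scal b.
  by exists c; rewrite -bP -row_mul -row_mul cP linearZ.
have [f fP] := fin_all_exists (fun j : 'I_k => uE (delta_mx 0 j)).
have aE : rho a = (\col_j f j) *m row i (rho a).
  apply/row_matrixP => j; rewrite [LHS]rowE fP row_mul.
  by apply/rowP => l; rewrite !mxE big_ord1 !mxE.
exists a, (\col_j f j), (row i (rho a)); split=> //.
by apply: contra a0 => /eqP E; rewrite aE E mul0mx.
Qed.

(** Multiplying a rank-one image [w *m v] by elements that carry [w] and [v] to basis vectors gives
    every matrix unit. *)
Lemma burnside M : exists a, rho a = M.
Proof.
have [c [w [v [cE w0 v0]]]] := burnside_rank1.
have e (p : 'I_k * 'I_k) : exists a, rho a = delta_mx p.1 p.2.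
  have [a aw] := col_irr (delta_mx p.1 0) w0.
  have [b vb] := row_irr (delta_mx 0 p.2) v0.
  exists (mul (mul a c) b).
  by rewrite !rhoM cE mulmxA aw -mulmxA vb mul_delta_mx.
have [f fP] := fin_all_exists e.
exists (\sum_i \sum_j M i j *: f (i, j)).
rewrite [RHS]matrix_sum_delta linear_sum; apply: eq_bigr => i _.
by rewrite linear_sum; apply: eq_bigr => j _; rewrite linearZ /= fP.
Qed.
End Burnside.

(** * Representations of *-simple algebras *)

Definition linear_of (K : fieldType) (U V : lmodType K) (f : U -> V)
    (f_lin : linear f) : {linear U -> V} :=
  HB.pack f (GRing.isLinear.Build K U V _ f f_lin).

Section StarSimple.
Variables (K : closedFieldType) (A : vectType K).
Variables (mul : A -> A -> A) (star : A -> A).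
Hypothesis mul_alg : is_algebra mul.
Hypothesis star_inv : is_involution mul star.
Hypothesis A_simple : star_simple mul star.

Let star_lin : linear star. Proof. by case: star_inv. Qed.
Let starM a b : star (mul a b) = mul (star b) (star a).
Proof. by case: star_inv. Qed.
Let starK : involutive star. Proof. by case: star_inv. Qed.
Let starL := linear_of star_lin.

Let mulr_lin b : linear (mul^~ b). Proof. by case: mul_alg. Qed.
Let mulA a b c : mul a (mul b c) = mul (mul a b) c.
Proof. by case: mul_alg. Qed.

Let star0 : star 0 = 0. Proof. exact: (linear0 starL). Qed.

Lemma star_ideal_ker_inj (V : vectType K) (f : {linear A -> V}) :
  (forall a x, f x = 0 -> f (mul a x) = 0 /\ f (mul x a) = 0) ->
  (forall x, f x = 0 -> f (star x) = 0) ->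
  (exists a, f a != 0) -> injective f.
Proof.
move=> f_id f_star [a fa]; have [_ /(_ (lker (linfun f)))] := A_simple.
have kerE x : (x \in lker (linfun f)) = (f x == 0) by rewrite memv_ker lfunE.
case.
- by move=> b x; rewrite !kerE => /eqP /(f_id b) [-> ->]; rewrite eqxx.
- move=> x; rewrite !kerE; apply/eqP/eqP => [/f_star|/f_star //].
  by rewrite starK.
- move=> ker0; apply: raddf_inj => x /eqP; rewrite -kerE ker0 memv0 => /eqP //.
- by move=> kerT; move: (memvf a); rewrite -kerT kerE (negPf fa).
Qed.

(** The joint kernel of [f] and [f \o star] contains all products, so it is a star-stable ideal. If
    [f] were nonzero, this ideal would be 0 and all products would vanish. *)
Lemma products_span (V : vectType K) (f : {linear A -> V}) :
  (forall a b, f (mul a b) = 0) -> forall a, f a = 0.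
Proof.
move=> fM a; apply/eqP; apply: contraT => fa.
have g_lin : linear (fun x => (f x, f (star x)) : V * V).
  by move=> c x y; rewrite star_lin !linearP.
have [[x [y xy]] _] := A_simple.
have inj : injective (linear_of g_lin).
  apply: star_ideal_ker_inj => [b z|z|]; first by rewrite /= !starM !fM.
    by case=> fz fsz; rewrite /= starK fz fsz.
  by exists a; apply/eqP => -[/eqP]; rewrite (negPf fa).
by case: xy; apply: inj; rewrite /= starM !fM star0 linear0.
Qed.

Definition is_rep k (rho : {linear A -> 'M[K]_k}) :=
  (forall a b, rho (mul a b) = rho a *m rho b) /\ exists a, rho a != 0.

(** Matrices act on rows from the right, so right multiplication is the homomorphism; it is nonzero
    because some product is. *)
Lemma regular_rep : exists k (rho : {linear A -> 'M[K]_k}), is_rep rho.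
Proof.
pose R a := linear_of (mulr_lin a).
pose f a := lin1_mx (v2r \o R a \o r2v).
have fE r a : r *m f a = v2r (mul (r2v r) a) by rewrite mul_rV_lin1.
have f_lin : linear f.
  move=> c a b; apply/row_matrixP => i; rewrite !rowE fE mulmxDr -scalemxAr !fE.
  by case: mul_alg => _ mull _; rewrite mull linearP.
exists _, (linear_of f_lin); split=> [a b|].
  by apply/row_matrixP => i; rewrite !rowE mulmxA /= !fE v2rK mulA.
have [[a [b ab]] _] := A_simple; exists b; apply/eqP => fb.
by case: ab; apply: (can_inj v2rK); rewrite linear0 -[a]v2rK -fE [f b]fb mulmx0.
Qed.

Lemma dual_rep_linear k (rho : {linear A -> 'M[K]_k}) :
  linear (fun a => (rho (star a))^T).
Proof. by move=> c a b; rewrite star_lin !linearP. Qed.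

(** The contragredient representation; it turns statements about rows into statements about
    columns. *)
Definition dual_rep k (rho : {linear A -> 'M[K]_k}) : {linear A -> 'M[K]_k} :=
  linear_of (@dual_rep_linear k rho).

Lemma dual_repP k (rho : {linear A -> 'M[K]_k}) : is_rep rho -> is_rep (dual_rep rho).
Proof.
move=> [rhoM [a a0]]; split=> [x y|] /=; first by rewrite starM rhoM trmx_mul.
by exists (star a); rewrite starK trmx_eq0.
Qed.

(** The orbit of [v] is a submodule. If it is proper, the action on it has degree less than [k] and
    is zero by minimality; so all products kill [v], hence all of [A] does. *)
Lemma minimal_rep_orbit k (rho : {linear A -> 'M[K]_k}) (v : 'rV[K]_k) :
  is_rep rho ->
  (forall j (sig : {linear A -> 'M[K]_j}), is_rep sig -> (k <= j)%N) ->
  (forall u, exists a, v *m rho a = u) \/ (forall a, v *m rho a = 0).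
Proof.
move=> [rhoM rho0] mink.
pose N := lin1_mx (mulmx v \o rho \o r2v).
have NE a : v2r a *m N = v *m rho a by rewrite mul_rV_lin1 /= v2rK.
have [full|nfull] := boolP (row_full N).
  left=> u; exists (r2v (u *m pinvmx N)); rewrite -NE r2vK mulmxKpV //.
  exact: submx_full.
right; pose B := row_base N.
have Bst a : (B *m rho a <= B)%MS.
  rewrite !eq_row_base (eqmxMr _ (eq_row_base N)).
  apply/row_subP => i; rewrite row_mul rowE -[delta_mx 0 i]r2vK NE -mulmxA -rhoM -NE.
  exact: submxMl.
have sig_lin : linear (fun a => B *m rho a *m pinvmx B).
  by move=> c a b; rewrite linearP mulmxDr mulmxDl -scalemxAr -scalemxAl.
have sigB a : linear_of sig_lin a *m B = B *m rho a by rewrite /= mulmxKpV.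
have sigM x y : linear_of sig_lin (mul x y) *m B =
    linear_of sig_lin x *m linear_of sig_lin y *m B.
  by rewrite sigB -mulmxA sigB mulmxA sigB rhoM mulmxA.
have NB : (N <= B)%MS by rewrite eq_row_base.
have sig0 a : linear_of sig_lin a = 0.
  apply: NNPP => /eqP ne; case/negP: nfull; rewrite -col_leq_rank.
  apply: mink (linear_of sig_lin) _; split; last by exists a.
  move=> x y; apply: (row_free_inj (row_base_free N)); exact: sigM.
have vM x y : v *m rho (mul x y) = 0.
  rewrite rhoM mulmxA -NE.
  have /submxP[C ->] := submx_trans (submxMl (v2r x) N) NB.
  by rewrite -mulmxA -sigB sig0 mul0mx mulmx0.
exact: (@products_span _ (mulmx v \o rho)).
Qed.

Lemma full_rep : exists k (rho : {linear A -> 'M[K]_k}),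
  is_rep rho /\ forall M, exists a, rho a = M.
Proof.
have [k [[rho rhoP] mink']] := classical_min regular_rep.
have mink j (sig : {linear A -> 'M[K]_j}) : is_rep sig -> (k <= j)%N.
  move=> sigP; rewrite leqNgt; apply/negP => jk.
  by apply: (mink' j jk); exists sig.
exists k, rho; split=> //; have [rhoM [a0 a0P]] := rhoP.
have col_orbit (w : 'cV[K]_k) :
    (forall u, exists a, rho a *m w = u) \/ (forall a, rho a *m w = 0).
  have [all|no] := @minimal_rep_orbit k (dual_rep rho) w^T (dual_repP rhoP) mink.
    left=> u; have [a aP] := all u^T; exists (star a).
    by apply: trmx_inj; rewrite trmx_mul -aP.
  right=> a; apply: trmx_inj; rewrite trmx_mul trmx0 -[RHS](no (star a)) /=.
  by rewrite starK.
have row_irr (v u : 'rV[K]_k) : v != 0 -> exists a, v *m rho a = u.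
  move=> v0; have [//|no] := minimal_rep_orbit v rhoP mink.
  (* A nonzero [v] killed by [rho] is orthogonal to every column orbit, so no orbit is everything.
     All orbits are then zero, against [rho a0 != 0]. *)
  case/negP: a0P; apply/eqP/trmx_inj/row_matrixP => i.
  have [all|] := col_orbit (col i 1%:M).
    case/eqP: v0; apply: trmx_inj; apply/row_matrixP => j.
    have [a aP] := all (delta_mx j 0).
    rewrite -tr_col colE -aP mulmxA no mul0mx !linear0 //.
  by move=> /(_ a0) E; rewrite -tr_col colE -[delta_mx i 0]mul1mx -colE E !linear0.
have col_irr (w u : 'cV[K]_k) : w != 0 -> exists a, rho a *m w = u.
  move=> w0; have [//|no] := col_orbit w.
  case/eqP: w0; apply/row_matrixP => i; rewrite rowE.
  have [i0 ri] : exists i, delta_mx 0 i != 0 :> 'rV[K]_k.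
    exists i; apply/eqP => /matrixP/(_ 0 i); rewrite !mxE !eqxx => /eqP.
    by rewrite oner_eq0.
  have [a <-] := row_irr _ (delta_mx 0 i) ri.
  by rewrite -mulmxA no mulmx0 row0.
by apply: (burnside rhoM) => //; exists a0.
Qed.

Section FullRep.
Variables (k : nat) (rho : {linear A -> 'M[K]_k}).
Hypothesis rhoP : is_rep rho.
Hypothesis rho_surj : forall M, exists a, rho a = M.

Let rhoM a b : rho (mul a b) = rho a *m rho b. Proof. by case: rhoP. Qed.

Lemma double_ker a : rho a = 0 -> rho (star a) = 0 -> a = 0.
Proof.
move=> ra rsa.
have g_lin : linear (fun x => (rho x, rho (star x)) : 'M[K]_k * 'M[K]_k).
  by move=> c x y; rewrite star_lin !linearP.
suff inj : injective (linear_of g_lin).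
  by apply: inj; rewrite /= ra rsa star0 linear0.
apply: star_ideal_ker_inj => [b x|x|] /=.
- by case=> rx rsx; rewrite !starM !rhoM rx rsx !mulmx0 !mul0mx.
- by case=> rx rsx; rewrite starK rx rsx.
- have [_ [b b0]] := rhoP; exists b; apply/eqP => -[/eqP].
  by rewrite (negPf b0).
Qed.

(** The kernel of [rho] plus its image under [star] is a star-stable ideal, hence 0 or [A]. *)
Lemma rep_dichotomy :
  injective rho \/ forall a, exists i j, [/\ rho i = 0, rho j = 0 & a = i + star j].
Proof.
pose I := lker (linfun rho); pose I' := lker (linfun (rho \o starL)).
have IE x : (x \in I) = (rho x == 0) by rewrite memv_ker lfunE.
have I'E x : (x \in I') = (rho (star x) == 0) by rewrite memv_ker lfunE.
have [_ /(_ (I + I')%VS)] := A_simple; case.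
- move=> a x /memv_addP[i]; rewrite IE => /eqP Ii [j]; rewrite I'E => /eqP Ij ->.
  case: mul_alg => _ mull mulr.
  have -> : mul a (i + j) = mul a i + mul a j := linearD (linear_of (mull a)) i j.
  have -> : mul (i + j) a = mul i a + mul j a := linearD (linear_of (mulr a)) i j.
  by split; apply: memv_add; rewrite ?IE ?I'E ?starM rhoM ?Ii ?Ij ?mulmx0 ?mul0mx.
- have st x : x \in (I + I')%VS -> star x \in (I + I')%VS.
    move=> /memv_addP[i]; rewrite IE => iI [j]; rewrite I'E => jI ->.
    have -> : star (i + j) = star j + star i by rewrite addrC; apply: (linearD starL).
    by apply: memv_add; rewrite ?IE ?I'E // starK.
  by move=> x; apply/idP/idP => [/st|/st //]; rewrite starK.
- move=> II0; left; apply: raddf_inj => x rx; apply/eqP; rewrite -memv0 -II0.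
  by rewrite -[x]addr0 memv_add ?mem0v // IE rx.
- move=> IIT; right=> a; have := memvf a; rewrite -IIT => /memv_addP[i].
  rewrite IE => /eqP Ii [j]; rewrite I'E => /eqP Ij ->.
  by exists i, (star j); rewrite starK.
Qed.

Lemma inj_rep_central : injective rho -> is_central mul.
Proof.
move=> inj; have [e eE] := rho_surj 1%:M; exists e; split.
- by move=> x; apply: inj; rewrite rhoM eE mul1mx.
- by move=> x; apply: inj; rewrite rhoM eE mulmx1.
move=> z; split=> [zc|[c ->] a]; last first.
  by apply: inj; rewrite !rhoM linearZ /= eE -scalemxAl -scalemxAr mul1mx mulmx1.
have comm M : rho z *m M = M *m rho z.
  by have [a <-] := rho_surj M; rewrite -!rhoM zc.
suff [c cE] : exists c, rho z = c%:M.
  by exists c; apply: inj; rewrite linearZ /= eE cE scalemx1.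
case: (posnP k) => [k0|kgt].
  by exists 0; apply/matrixP => -[i ik]; exfalso; rewrite k0 in ik.
pose o := Ordinal kgt; exists (rho z o o); apply/matrixP => i j.
(* Entry [(i, o)] of this commutation equates entry [(i, j)] of [rho z] with that of a scalar
   matrix. *)
have := comm (delta_mx j o) => /matrixP/(_ i o).
rewrite !mxE (bigD1 j) //= !mxE !eqxx mulr1 big1 ?addr0 => [->|l lj]; last first.
  by rewrite mxE (negPf lj) mulr0.
rewrite (bigD1 o) //= !mxE eqxx andbT big1 ?addr0 => [|l lo].
  by rewrite mulr_natl.
by rewrite mxE (negPf lo) andbF mul0r.
Qed.

(** Otherwise the unit is [e = i + star j] with [rho i = rho j = 0]. Commutators of [i] lie in the
    kernels of both [rho] and [rho \o star], so [i] is central, a multiple of [e], hence 0. Then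
    [e = star j = j] is killed by [rho]. *)
Lemma central_rep_inj : is_central mul -> injective rho.
Proof.
move=> [e [e1 e2 ctr]]; have [//|dec] := rep_dichotomy; exfalso.
have [i [j [ri rj eij]]] := dec e.
case: mul_alg => _ mull _.
have mulDr x y z : mul x (y + z) = mul x y + mul x z := linearD (linear_of (mull x)) y z.
have mulDl x y z : mul (x + y) z = mul x z + mul y z := linearD (linear_of (mulr_lin z)) x y.
have ic : in_center mul i.
  move=> a; apply/eqP; rewrite -subr_eq0; apply/eqP.
  have E : mul i a - mul a i = mul a (star j) - mul (star j) a.
    apply/eqP; rewrite subr_eq addrAC eq_sym subr_eq -mulDl -mulDr.
    by rewrite [star j + i]addrC -eij e1 e2.
  apply: double_ker; first by rewrite linearB /= !rhoM ri mulmx0 mul0mx subrr.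
  have -> : star (mul i a - mul a i) = star (mul a (star j)) - star (mul (star j) a).
    by rewrite E; apply: (linearB starL).
  by rewrite linearB /= !starM starK !rhoM rj mulmx0 mul0mx subrr.
have es : star e = e by rewrite -[LHS]e1 -{1}[e]starK -starM e1 starK.
have re : rho e != 0.
  have [_ [a a0]] := rhoP; apply: contra a0 => /eqP E.
  by rewrite -[a]e1 rhoM E mul0mx.
have [/(_ ic)[c iE] _] := ctr i.
move/eqP: ri; rewrite iE linearZ scaler_eq0 (negPf re) orbF => /eqP c0.
case/eqP: re; rewrite -es eij iE c0 scale0r add0r starK; exact: rj.
Qed.

End FullRep.
End StarSimple.

(** * Embeddings and adjoint forms *)

(** Common form of the three degree bounds: on the rows of [W], symmetric elements induce every
    operator self-adjoint for the form [diag_mx D]. *)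
Lemma capelli_bound_compression (K : closedFieldType) (A : vectType K)
    (mul : A -> A -> A) (star : A -> A) k (phi : {linear A -> 'M[K]_k})
    m l (W : 'M[K]_(l, k)) (D : 'rV[K]_l) :
  star 0 = 0 -> star_identity mul star (capelli_poly K m) ->
  (forall a b, phi (mul a b) = phi a *m phi b) ->
  row_free W -> (forall i, D 0 i != 0) ->
  (forall X, X *m diag_mx D = diag_mx D *m X^T ->
     exists a, symmetric_elt star a /\ W *m phi a = X *m W) ->
  (l <= m)%N.
Proof.
move=> star0 idA phiM Wf D0 lift.
pose ev i : 'rV[K]_l := \row_j (j == i :> nat)%:R.
have evE (i : 'I_l) : ev i = delta_mx 0 i by apply/rowP => j; rewrite !mxE.
pose c i := if insub i is Some j then D 0 j else 1.
apply: (@capelli_bound K A mul star k phi m l (fun i => ev i *m W) c) => //.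
- move=> i il; rewrite /c insubT /= D0 mulmx_free_eq0 //; split=> //.
  rewrite (evE (Ordinal il)); apply/eqP => /matrixP/(_ 0 (Ordinal il)).
  by rewrite !mxE !eqxx => /eqP; rewrite oner_eq0.
- move=> d; have [|a [asym aW]] := lift (diag_mx (\row_j d j)).
    by rewrite tr_diag_mx diag_mxC.
  exists a; split=> // i il; rewrite -mulmxA aW mulmxA scalemxAl; congr (_ *m _).
  by rewrite (evE (Ordinal il)) -rowE row_diag_mx mxE.
- move=> j jl; pose i0 := Ordinal (ltnW jl); pose i1 := Ordinal jl.
  pose S : 'M[K]_l := delta_mx i0 i1 + delta_mx i1 i0.
  (* Self-adjoint because [S] is symmetric; it sends basis vector [j] to [D 0 j] times basis vector
     [j.+1]. *)
  have [|a [asym aW]] := lift (diag_mx D *m S).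
    rewrite trmx_mul tr_diag_mx mulmxA; congr (_ *m _ *m _).
    by rewrite linearD /= !trmx_delta addrC.
  exists a; split=> //; rewrite -mulmxA aW mulmxA scalemxAl; congr (_ *m _).
  rewrite /c (insubT (fun i => i < l)%N (ltnW jl)) [ev j](evE i0).
  rewrite [ev j.+1](evE i1) mulmxA -rowE row_diag_mx -scalemxAl.
  congr (_ *: _).
  rewrite mulmxDr mul_delta_mx mul_delta_mx_0 ?addr0 //.
  by rewrite -val_eqE /= ltn_eqF.
Qed.

Section Embeddings.
Variables (K : closedFieldType) (A : vectType K).
Variables (mul : A -> A -> A) (star : A -> A).

(** [V] includes one symplectic space isometrically into a larger one, half by half; operators are
    extended by zero on the orthogonal complement. *)
Lemma star_embedding_symp_widen l N
    (phi : {linear A -> 'M[K]_(l + l)}) :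
  star_embedding mul star (@mulmx K (l + l) (l + l) (l + l)) (@symp K (l + l)) phi ->
  ~~ odd N -> (l <= N./2)%N ->
  exists psi : {linear A -> 'M[K]_N},
    star_embedding mul star (@mulmx K N N N) (@symp K N) psi.
Proof.
move=> [phi_inj phiM phi_star] /even_halfK; rewrite -addnn.
move: N./2 => m <- {N} lm.
pose W : 'M[K]_(l, m) := pid_mx l.
have WW : W *m W^T = 1%:M by rewrite tr_pid_mx pid_mx_id // pid_mx_1.
pose V := block_mx W 0 0 W.
have VV : V *m V^T = 1%:M.
  rewrite tr_block_mx !trmx0 mulmx_block !mulmx0 !mul0mx !addr0 !add0r WW.
  by rewrite -scalar_mx_block.
have JV : symp_mx K (m + m) *m V^T = V^T *m symp_mx K (l + l).
  rewrite !symp_mxE tr_block_mx !trmx0 !mulmx_block !mulmx0 !mul0mx !addr0 !add0r.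
  by rewrite !mulNmx !mulmxN !mulmx1 !mul1mx.
have el : ~~ odd (l + l) by rewrite addnn odd_double.
have em : ~~ odd (m + m) by rewrite addnn odd_double.
have VJ : V *m symp_mx K (m + m) = symp_mx K (l + l) *m V.
  apply: trmx_inj; rewrite !trmx_mul !symp_mx_tr // mulNmx mulmxN JV //.
have psi_lin : linear (fun a => V^T *m phi a *m V).
  by move=> c a b; rewrite linearP mulmxDr mulmxDl -scalemxAr -scalemxAl.
exists (linear_of psi_lin); split=> /=.
- move=> a b /(congr1 (fun M => V *m M *m V^T)).
  by rewrite !mulmxA !VV !mul1mx -!mulmxA !VV !mulmx1 => /phi_inj.
- move=> a b; rewrite phiM !mulmxA -[_ *m V *m _]mulmxA VV mulmx1 //.
- move=> a; rewrite phi_star /symp !symp_mx_inv // !mulmxN mulNmx.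
  congr (- _); rewrite !trmx_mul trmxK !mulmxA JV -!mulmxA VJ.
  by rewrite !mulmxA.
Qed.

Hypothesis star_inv : is_involution mul star.

(* W + W^* with its hyperbolic symplectic form, for any module W. *)
Lemma double_rep_embedding k (rho : {linear A -> 'M[K]_k}) :
  (forall a b, rho (mul a b) = rho a *m rho b) ->
  (forall a, rho a = 0 -> rho (star a) = 0 -> a = 0) ->
  exists phi : {linear A -> 'M[K]_(k + k)},
    star_embedding mul star (@mulmx K (k + k) (k + k) (k + k))
      (@symp K (k + k)) phi.
Proof.
case: star_inv => star_lin starM starK rhoM ker0.
have phi_lin : linear (fun a => block_mx (rho a) 0 0 (rho (star a))^T).
  move=> c a b; rewrite star_lin !linearP /= scale_block_mx add_block_mx.
  by rewrite !scaler0 !addr0.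
have ek : ~~ odd (k + k) by rewrite addnn odd_double.
exists (linear_of phi_lin); split=> /=.
- apply: (@raddf_inj _ _ (linear_of phi_lin)) => a /=.
  rewrite -[X in _ = X]block_mx0 => /eq_block_mx[ra _ _ /(congr1 trmx)].
  by rewrite trmxK trmx0; apply: ker0.
- move=> a b; rewrite mulmx_block !mulmx0 !mul0mx !addr0 !add0r starM !rhoM.
  by rewrite trmx_mul.
- move=> a; rewrite /symp symp_mx_inv // symp_mxE tr_block_mx opp_block_mx.
  rewrite !trmx0 trmxK !mulmx_block !oppr0 !opprK !mulmx0 !mul0mx !addr0 !add0r.
  by rewrite !mul1mx !mulNmx !mulmxN !mul1mx !mulmx1 !opprK oppr0 starK.
Qed.

End Embeddings.

(** * Bilinear forms whose adjunction is the involution *)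

Section Forms.
Variables (K : closedFieldType) (A : vectType K).
Variables (mul : A -> A -> A) (star : A -> A).
Hypothesis star_inv : is_involution mul star.
Variables (k : nat) (rho : {linear A -> 'M[K]_k}).
Hypothesis rhoM : forall a b, rho (mul a b) = rho a *m rho b.
Hypothesis rho_neq0 : exists a, rho a != 0.
Hypothesis rho_surj : forall M, exists a, rho a = M.
Hypothesis rho_inj : injective rho.

Let star_lin : linear star. Proof. by case: star_inv. Qed.
Let starM a b : star (mul a b) = mul (star b) (star a).
Proof. by case: star_inv. Qed.
Let starK : involutive star. Proof. by case: star_inv. Qed.
Let starL := linear_of star_lin.
Let star0 : star 0 = 0. Proof. exact: (linear0 starL). Qed.

(** For the form [u *m X *m v^T] on row vectors, [rho (star a)] is the adjoint of [rho a]. *)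
Definition adjoint_form (X : 'M[K]_k) :=
  forall a, rho (star a) *m X = X *m (rho a)^T.

(** The radical is stable under the image of [rho], which is the full matrix algebra; a nonzero
    radical therefore contains all rows. *)
Lemma adjoint_form_unit X : adjoint_form X -> X != 0 -> X \in unitmx.
Proof.
move=> Xadj X0; rewrite -unitmx_tr -row_free_unit.
apply: inj_row_free => w wX; apply: contraNeq X0 => w0.
have [i wi] : exists i, w 0 i != 0.
  apply/existsP; apply: contraNT w0 => /existsPn no; apply/eqP/rowP => i.
  by apply/eqP; rewrite mxE -[_ == _]negbK no.
apply/eqP/trmx_inj/row_matrixP => j; rewrite linear0 row0 rowE.
have [a aE] := rho_surj (delta_mx i j).
have := congr1 (fun M => w *m M) (congr1 trmx (Xadj a)) => /=.
rewrite !trmx_mul trmxK aE !mulmxA wX mul0mx => /esym/eqP.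
have -> : w *m delta_mx i j = w 0 i *: delta_mx 0 j.
  apply/rowP => l; rewrite !mxE (bigD1 i) //= big1 ?addr0 ?mxE ?eqxx // => s si.
  by rewrite mxE (negPf si) mulr0.
by rewrite -scalemxAl scaler_eq0 (negPf wi) => /eqP.
Qed.

Lemma adjoint_form_tr X : adjoint_form X -> adjoint_form X^T.
Proof.
move=> Xadj a; apply: trmx_inj; rewrite !trmx_mul !trmxK.
by rewrite -{2}[a]starK Xadj.
Qed.

(* Column i of the form is column j of rho (e_(o, i)^* ), for matrix units e. *)
Lemma adjoint_form_exists : exists2 X, adjoint_form X & X != 0.
Proof.
have [a0 a0P] := rho_neq0.
have k_gt0 : (0 < k)%N.
  rewrite lt0n; apply: contra a0P => /eqP k0.
  by apply/eqP/matrixP => -[i ik]; exfalso; rewrite k0 in ik.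
pose o := Ordinal k_gt0.
have [e eE] := fin_all_exists (fun i => rho_surj (delta_mx o i)).
have eo : rho (star (e o)) != 0.
  apply/eqP => E; have : delta_mx o o = 0 :> 'M[K]_k.
    rewrite -eE -[e o]starK (_ : star (e o) = 0).
      by rewrite star0 linear0.
    by apply: rho_inj; rewrite E linear0.
  by move=> /matrixP/(_ o o); rewrite !mxE !eqxx => /eqP; rewrite oner_eq0.
have [j cj] : exists j, col j (rho (star (e o))) != 0.
  apply/existsP; apply: contraNT eo => /existsPn no; apply/eqP/trmx_inj.
  apply/row_matrixP => i; rewrite -tr_col linear0 row0.
  by apply/eqP; rewrite trmx_eq0 -[_ == _]negbK no.
exists (\matrix_(r, i) rho (star (e i)) r j); last first.
  apply: contra cj => /eqP/matrixP X0; apply/eqP/colP => r.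
  by have := X0 r o; rewrite !mxE.
move=> a; apply/matrixP => r i.
(* Applying [star] and [rho] to this expansion and reading off column [j] gives the adjunction. *)
have eia : mul (e i) a = \sum_l rho a i l *: e l.
  apply: rho_inj; rewrite rhoM linear_sum; apply/matrixP => s t.
  rewrite eE summxE mxE (bigD1 i) //= [X in _ + X]big1 ?addr0; last first.
    by move=> l li; rewrite mxE (negPf li) andbF mul0r.
  rewrite (bigD1 t) //= [X in _ = _ + X]big1 ?addr0; last first.
    by move=> l lt; rewrite linearZ /= eE !mxE [t == l]eq_sym (negPf lt) andbF mulr0.
  by rewrite linearZ /= eE !mxE !eqxx andbT mulrC.
transitivity (rho (star (mul (e i) a)) r j).
  by rewrite starM rhoM !mxE; apply: eq_bigr => l _; rewrite !mxE.
rewrite eia -[star _]/(starL _) (linear_sum starL) linear_sum summxE !mxE.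
apply: eq_bigr => l _.
by rewrite (linearZ_LR starL) linearZ !mxE mulrC.
Qed.

(** The form [X + X^T] is again adjoint: either it vanishes and [X] is skew, or it is itself
    symmetric and nonzero. *)
Lemma adjoint_form_sym_or_skew :
  exists X, [/\ adjoint_form X, X \in unitmx & X^T = X \/ X^T = - X].
Proof.
have [X Xadj X0] := adjoint_form_exists.
have [E|S0] := eqVneq (X + X^T) 0.
  exists X; split=> //; first exact: adjoint_form_unit.
  by right; apply/eqP; rewrite -addr_eq0 addrC E.
have Sadj : adjoint_form (X + X^T).
  by move=> a; rewrite mulmxDr mulmxDl Xadj (adjoint_form_tr Xadj).
exists (X + X^T); split=> //; first exact: adjoint_form_unit.
by left; rewrite linearD /= trmxK addrC.
Qed.

End Forms.

(** * Degree bounds in the orthogonal, symplectic and exchange cases *)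

Section Bounds.
Variables (K : closedFieldType) (A : vectType K).
Variables (mul : A -> A -> A) (star : A -> A).
Hypothesis star_inv : is_involution mul star.
Hypothesis K2 : 2%:R != 0 :> K.
Variable m : nat.
Hypothesis idA : star_identity mul star (capelli_poly K m).

Let star_lin : linear star. Proof. by case: star_inv. Qed.
Let starK : involutive star. Proof. by case: star_inv. Qed.
Let starL := linear_of star_lin.
Let star0 : star 0 = 0. Proof. exact: (linear0 starL). Qed.

Lemma adjoint_form_conj k (rho : {linear A -> 'M[K]_k}) (P T : 'M[K]_k) :
  (forall a b, rho (mul a b) = rho a *m rho b) -> (forall M, exists a, rho a = M) ->
  injective rho -> P \in unitmx -> adjoint_form star rho T ->
  exists sig : {linear A -> 'M[K]_k},
    [/\ forall a b, sig (mul a b) = sig a *m sig b, forall M, exists a, sig a = M,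
        injective sig & adjoint_form star sig (P *m T *m P^T)].
Proof.
move=> rhoM rho_surj rho_inj Pu Tadj.
have sig_lin : linear (fun a => P *m rho a *m invmx P).
  by move=> c a b; rewrite linearP mulmxDr mulmxDl -scalemxAr -scalemxAl.
exists (linear_of sig_lin); split=> [a b|M|a b|a] /=.
- by rewrite rhoM !mulmxA mulmxKV.
- have [a aE] := rho_surj (invmx P *m M *m P); exists a.
  by rewrite aE !mulmxA mulmxV // mul1mx mulmxK.
- by move/(can_inj (mulmxK (etrans (unitmx_inv P) Pu)))/(can_inj (mulKmx Pu)) => /rho_inj.
- rewrite !mulmxA mulmxKV // -!mulmxA [rho _ *m _]mulmxA Tadj !trmx_mul !mulmxA.
  by rewrite -[_ *m P^T *m _]mulmxA -trmx_mul mulVmx // trmx1 mulmx1.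
Qed.

Lemma orthogonal_bound k (rho : {linear A -> 'M[K]_k}) (T : 'M[K]_k) :
  (forall a b, rho (mul a b) = rho a *m rho b) -> (forall M, exists a, rho a = M) ->
  injective rho -> adjoint_form star rho T -> T \in unitmx -> T^T = T ->
  (k <= m)%N.
Proof.
move=> rhoM rho_surj rho_inj Tadj Tu TT.
have [P Pu [d dE]] := symmetric_diagonalize K2 TT.
have [sig [sigM sig_surj sig_inj]] := adjoint_form_conj rhoM rho_surj rho_inj Pu Tadj.
rewrite dE => sigD.
have Du : diag_mx d \in unitmx by rewrite -dE !unitmx_mul unitmx_tr Pu Tu.
apply: (@capelli_bound_compression K A mul star k sig m k 1%:M d) => //.
- by rewrite row_free_unit unitmx1.
- move=> i; apply: contraTneq Du => di; rewrite unitmxE det_diag (bigD1 i) //=.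
  by rewrite di mul0r unitr0.
- move=> X XD; have [a aX] := sig_surj X; exists a; split; last first.
    by rewrite mul1mx mulmx1.
  apply: sig_inj; apply: (can_inj (mulmxK Du)).
  by rewrite sigD aX XD.
Qed.

(** In a Darboux basis the involution becomes [symp]. The block-diagonal matrix of any [X] and [X^T]
    is symmetric for it and acts as [X] on the first half of the coordinates, which bounds [l]. *)
Lemma symplectic_rep k (rho : {linear A -> 'M[K]_k}) (T : 'M[K]_k) :
  (forall a b, rho (mul a b) = rho a *m rho b) -> (forall M, exists a, rho a = M) ->
  injective rho -> adjoint_form star rho T -> T \in unitmx -> T^T = - T ->
  exists l, exists2 phi : {linear A -> 'M[K]_(l + l)},
    star_embedding mul star (@mulmx K (l + l) (l + l) (l + l)) (@symp K (l + l)) phi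
    & (l <= m)%N.
Proof.
move=> rhoM rho_surj rho_inj Tadj Tu TT.
have [l [P [kl PTP]]] := skew_darboux K2 TT Tu; subst k; exists l.
have el : ~~ odd (l + l) by rewrite addnn odd_double.
have Ju := symp_mx_unit K el.
have Pu : P \in unitmx by move: Ju; rewrite -PTP !unitmx_mul => /andP[/andP[]].
have [sig [sigM sig_surj sig_inj]] := adjoint_form_conj rhoM rho_surj rho_inj Pu Tadj.
rewrite PTP => sigJ.
have sig_star a : sig (star a) = symp (sig a) by rewrite /symp -sigJ mulmxK.
exists sig; first by split.
apply: (@capelli_bound_compression K A mul star _ sig m l (row_mx 1%:M 0) (const_mx 1)) => //.
- apply: inj_row_free => v; rewrite mul_mx_row mulmx1 mulmx0 -[X in _ = X]row_mx0.
  by case/eq_row_mx.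
- by move=> i; rewrite mxE oner_neq0.
- move=> X _; have [a aX] := sig_surj (block_mx X 0 0 X^T); exists a; split.
    apply: sig_inj; rewrite sig_star aX /symp symp_mx_inv // symp_mxE.
    rewrite tr_block_mx opp_block_mx !mulmx_block !trmx0 trmxK.
    rewrite !oppr0 !opprK !mulmx0 !mul0mx !addr0 !add0r.
    by rewrite !mul1mx !mulNmx !mulmxN !mul1mx !mulmx1 !opprK oppr0.
  rewrite aX mul_row_block mul_mx_row mul1mx !mulmx0 !mul0mx !addr0 mulmx1 //.
Qed.

(** If [b = i + star j] with [i] and [j] in the kernel, the symmetric element [j + star j] has the
    same image as [b]; so symmetric elements already reach every matrix. *)
Lemma exchange_bound k (rho : {linear A -> 'M[K]_k}) :
  (forall a b, rho (mul a b) = rho a *m rho b) -> (forall M, exists a, rho a = M) ->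
  (forall a, exists i j, [/\ rho i = 0, rho j = 0 & a = i + star j]) ->
  (k <= m)%N.
Proof.
move=> rhoM rho_surj dec.
apply: (@capelli_bound_compression K A mul star k rho m k 1%:M (const_mx 1)) => //.
- by rewrite row_free_unit unitmx1.
- by move=> i; rewrite mxE oner_neq0.
move=> X _; have [b <-] := rho_surj X; have [i [j [ri rj ->]]] := dec b.
exists (j + star j); split; last by rewrite mul1mx mulmx1 !linearD /= ri rj.
rewrite /symmetric_elt; have -> : star (j + star j) = star j + star (star j).
  exact: (linearD starL).
by rewrite starK addrC.
Qed.

End Bounds.

(** * Assembly of the embeddings into symplectic matrix algebras *)

Theorem corollary2 (K : closedFieldType) (charK : 2%N \notin [pchar K])
    (n : nat) (n_gt0 : (0 < n)%N) (n_even : ~~ odd n)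
    (A : vectType K) (mul : A -> A -> A) (star : A -> A)
    (mul_alg : is_algebra mul) (star_inv : is_involution mul star)
    (A_simple : star_simple mul star)
    (Id_incl : forall f : star_poly K,
       star_identity (@mulmx K n n n) (@symp K n) f ->
       star_identity mul star f) :
  (is_central mul ->
     exists phi : {linear A -> 'M[K]_n},
       star_embedding mul star (@mulmx K n n n) (@symp K n) phi)
  /\
  (~ is_central mul ->
     exists phi : {linear A -> 'M[K]_(2 * n)},
       star_embedding mul star
         (@mulmx K (2 * n)%N (2 * n)%N (2 * n)%N) (@symp K (2 * n)%N) phi).
Proof.
have K2 := pchar2_two_neq0 charK.
have idA := Id_incl _ (capelli_symp_identity K2 n_gt0 n_even).
have [k [rho [rhoP rho_surj]]] := full_rep mul_alg star_inv A_simple.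
have [rhoM rho0] := rhoP.
have [dbl dblP] := double_rep_embedding star_inv rhoM
  (double_ker star_inv A_simple rhoP).
split=> [central|ncentral].
  have rho_inj := central_rep_inj mul_alg star_inv A_simple rhoP central.
  have [T [Tadj Tu [TT|TT]]] :=
    adjoint_form_sym_or_skew star_inv rhoM rho0 rho_surj rho_inj.
    (* For a symmetric form, [k] is at most half of [n], so the doubled representation of degree
       [k + k] fits. *)
    apply: (star_embedding_symp_widen dblP n_even).
    exact: (orthogonal_bound star_inv K2 idA rhoM rho_surj rho_inj Tadj Tu TT).
  have [l [phi phiP lm]] :=
    symplectic_rep star_inv K2 idA rhoM rho_surj rho_inj Tadj Tu TT.
  exact: (star_embedding_symp_widen phiP n_even lm).
have [rho_inj|dec] := rep_dichotomy mul_alg star_inv A_simple rhoP.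
  by case: ncentral; apply: inj_rep_central rhoP rho_surj rho_inj.
apply: (star_embedding_symp_widen dblP); first by rewrite mul2n odd_double.
(* The half-size of the target is now [n], and [k] is at most half of [n]. *)
rewrite mul2n doubleK; apply: leq_trans (exchange_bound star_inv idA rhoM rho_surj dec) _.
by rewrite -leq_double even_halfK // -addnn leq_addr.
Qed.
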